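(* Let $G$ be a finite simple graph with girth at least $9$. Then $\chi_b(G) \ge m(G) - 1$.
   Context: A b-vertex of a (proper) vertex coloring is a vertex that has a neighbor of every color other than its own. A b-coloring of $G$ is a proper vertex coloring in which every color class contains a b-vertex. The b-chromatic number $\chi_b(G)$ is the largest integer $k$ such that $G$ has a b-coloring with exactly $k$ colors. $m(G)$ denotes the largest integer $k$ such that $G$ has at least $k$ vertices of degree at least $k-1$. The girth of $G$ is the length of a shortest cycle of $G$ (infinite if $G$ is acyclic). *)

(* Defs.v *)
From mathcomp Require Import all_boot.
Set Implicit Arguments.
Unset Strict Implicit.
Unset Printing Implicit Defensive.

(* A finite simple graph is a finType T of vertices with a
   symmetric irreflexive adjacency relation e : rel T. *)

Section Graph.
Variables (T : finType) (e : rel T).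

Definition degree (v : T) : nat := #|[set w | e v w]|.

(* The bound 2 < n excludes the degenerate closed walks x and x, y, x. *)
Definition has_cycle_of_length (n : nat) : bool :=
  (2 < n) && [exists c : n.-tuple T, ucycleb e c].

(* None stands for infinite girth.  A cycle has at most #|T| vertices, so the
   first match in 0, ..., #|T| is the length of a shortest cycle. *)
Definition girth : option nat :=
  ohead [seq n <- iota 0 #|T|.+1 | has_cycle_of_length n].

Definition girth_at_least (g : nat) : bool :=
  if girth is Some l then g <= l else true.

Definition proper_coloring (k : nat) (f : {ffun T -> 'I_k}) : bool :=
  [forall x, forall y, e x y ==> (f x != f y)].

Definition b_vertex (k : nat) (f : {ffun T -> 'I_k}) (v : T) : bool :=
  [forall d, (d != f v) ==> [exists w, e v w && (f w == d)]].

(* As c ranges over all of 'I_k, each color is used: f has exactly k colors. *)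
Definition b_coloring (k : nat) (f : {ffun T -> 'I_k}) : bool :=
  proper_coloring f && [forall c, exists v, (f v == c) && b_vertex f v].

Definition has_b_coloring (k : nat) : bool :=
  [exists f : {ffun T -> 'I_k}, b_coloring f].

(* The ranges of both maxima lose nothing: see leq_chi_b, has_b_coloring_chi_b,
   leq_m_degree and m_degree_attained below. *)
Definition chi_b : nat := \max_(k < #|T|.+1 | has_b_coloring k) k.

Definition m_degree : nat :=
  \max_(k < #|T|.+1 | k <= #|[set v | k.-1 <= degree v]|) k.

Lemma girth_at_leastP (g : nat) :
  girth_at_least g <->
  (forall c : seq T, 2 < size c -> ucycle e c -> g <= size c).
Proof.
have cycE (c : seq T) : 2 < size c -> ucycle e c -> has_cycle_of_length (size c).
  by move=> c2 ec; rewrite /has_cycle_of_length c2; apply/existsP; exists (in_tuple c).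
rewrite /girth_at_least /girth; set s := filter _ _.
have s_srt : sorted leq s.
  by apply: sorted_filter; [exact: leq_trans | exact: iota_sorted].
have memS n : (n \in s) = has_cycle_of_length n.
  rewrite mem_filter mem_iota /= add0n ltnS andb_idr //.
  case/andP=> _ /existsP[c /andP[_ uc]].
  by rewrite -(size_tuple c) -(card_uniqP uc) max_card.
split=> [|H].
  case: s s_srt memS => [|l s'] /= srt memS gl c c2 ec.
    by have := cycE _ c2 ec; rewrite -memS.
  apply: leq_trans gl _.
  have := cycE _ c2 ec; rewrite -memS inE => /predU1P[-> //|].
  by move/(order_path_min leq_trans)/allP: srt; apply.
case: s {s_srt} memS => [//|l s'] /(_ l) /=; rewrite inE eqxx.
case/esym/andP=> l2 /existsP[c ec].
by rewrite -(size_tuple c); apply: H; rewrite ?size_tuple.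
Qed.

Lemma has_b_coloring_leq_card (k : nat) : has_b_coloring k -> k <= #|T|.
Proof.
case/existsP=> f /andP[_ /forallP bf]; rewrite -[X in X <= _]card_ord.
have /(_ _)/existsP/sigW g c := bf c.
have gK : cancel (fun c => sval (g c)) f.
  by move=> c; case: (g c) => v /= /andP[/eqP].
exact: leq_card (can_inj gK).
Qed.

Lemma leq_chi_b (k : nat) : has_b_coloring k -> k <= chi_b.
Proof.
move=> bk; have kT : k < #|T|.+1 by rewrite ltnS has_b_coloring_leq_card.
exact: (@leq_bigmax_cond _ _ (fun i : 'I_#|T|.+1 => val i) (Ordinal kT)).
Qed.

Lemma exists_b_coloring : irreflexive e -> symmetric e ->
  exists k, has_b_coloring k.
Proof.
move=> eI eS.
pose P k := [exists f : {ffun T -> 'I_k}, proper_coloring f].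
have exP : exists k, P k.
  exists #|T|; apply/existsP; exists [ffun x => enum_rank x].
  apply/forallP=> x; apply/forallP=> y; apply/implyP=> exy; rewrite !ffunE.
  by apply: contraTneq exy => /enum_rank_inj ->; rewrite eI.
case: (ex_minnP exP) => k /existsP[f pf] kmin; exists k.
apply/existsP; exists f; rewrite /b_coloring pf /=; apply/forallP=> c.
have {}pf x y : e x y -> f x != f y.
  by move/forallP: pf => /(_ x)/forallP/(_ y)/implyP.
apply: contraT => /existsPn nob.
case: k f kmin c pf nob => [|k] f kmin c pf nob; first by case: c nob.
have rec (v : T) : {d : 'I_k | if f v == c
    then [forall w, e v w ==> (f w != lift c d)] else f v == lift c d}.
  apply: sigW; case: (eqVneq (f v) c) => [fv|nfv]; last first.
    have [j fvE _] := unlift_some (etrans (congr1 negb (eq_sym _ _)) nfv).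
    by exists j; rewrite -fvE.
  have := nob v; rewrite fv eqxx /= => /forallPn[d].
  rewrite negb_imply fv => /andP[dc /existsPn nw].
  have [j dE _] := unlift_some (etrans (congr1 negb (eq_sym _ _)) dc).
  exists j; apply/forallP=> w; apply/implyP=> evw.
  by have := nw w; rewrite evw dE.
suff /kmin : P k by rewrite ltnn.
apply/existsP; exists [ffun v => sval (rec v)].
apply/forallP=> x; apply/forallP=> y; apply/implyP=> exy; rewrite !ffunE.
have eyx : e y x by rewrite eS.
apply/eqP; case: (rec x) (rec y) => [d Hd] [d' Hd'] /= dd'; subst d'.
have := pf _ _ exy; case: ifP Hd Hd' => [/eqP fx|nfx] Hd; case: ifP => [/eqP fy|nfy] Hd'.
- by rewrite fx fy eqxx.
- by move/forallP/(_ y): Hd; rewrite exy Hd'.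
- by move/forallP/(_ x): Hd'; rewrite eyx Hd.
- by rewrite (eqP Hd) (eqP Hd') eqxx.
Qed.

Lemma has_b_coloring_chi_b : irreflexive e -> symmetric e ->
  has_b_coloring chi_b.
Proof.
move=> eI eS; have [k bk] := exists_b_coloring eI eS.
have kT : k < #|T|.+1 by rewrite ltnS has_b_coloring_leq_card.
rewrite /chi_b (bigop.bigmax_eq_arg (Ordinal kT)) //.
by case: arg_maxnP.
Qed.

Lemma leq_m_degree (k : nat) :
  k <= #|[set v | k.-1 <= degree v]| -> k <= m_degree.
Proof.
move=> bk; have kT : k < #|T|.+1 by rewrite ltnS (leq_trans bk) ?max_card.
exact: (@leq_bigmax_cond _ _ (fun i : 'I_#|T|.+1 => val i) (Ordinal kT)).
Qed.

Lemma m_degree_attained : m_degree <= #|[set v | m_degree.-1 <= degree v]|.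
Proof.
rewrite {1 2}/m_degree (bigop.bigmax_eq_arg ord0) //.
by case: arg_maxnP.
Qed.

End Graph.

(* Main.v *)
Require Import Defs.
From mathcomp Require Import all_boot.

(* Since the girth is at least 9, two non-backtracking paths with the same ends
   and total length at most 8 coincide.  Let W be a set of n vertices of degree
   at least n - 1 such that all vertices outside the closed neighbourhood of W
   have degree less than n, and give the vertices of W distinct colours.  Call
   link a vertex outside W that lies on a path of length 2 or 3 between two
   vertices of W.  If no outside vertex u is encircled, i.e. within distance 2 of
   all of W through W, then the links can be coloured properly with no repeated
   colour around any vertex of W, by giving each link the colour of a nearby
   vertex of W; the uniqueness of short paths excludes all conflicts.  The other
   neighbours of W are then free to supply the missing colours, and the rest of
   the graph is coloured greedily.

   Take now for W the m = m(G) vertices of largest degree.  If some u encircles W,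
   then W and u form a tree of depth 2 with root u.  Either one can replace a
   vertex of W by a vertex outside and obtain a set of m vertices that is not
   encircled, or dropping a vertex of W at distance 2 from u gives a set of m - 1
   vertices, each with a spare neighbour, to which the argument applies with
   m - 1 colours. *)

Set Implicit Arguments.
Unset Strict Implicit.
Unset Printing Implicit Defensive.

(** * Uniqueness of short paths *)

Section LargeGirth.
Variables (T : finType) (e : rel T).

(** Non-backtracking: only entries two apart are compared, since adjacency already separates
    consecutive ones. *)
Fixpoint reduced (s : seq T) : bool :=
  if s is x :: s' then (if s' is _ :: z :: _ then x != z else true) && reduced s'
  else true.

Lemma reduced_tail x s : reduced (x :: s) -> reduced s.
Proof. by move=> /= /andP[]. Qed.

(** The two side conditions concern the only triples that straddle the junction of [rev s] and
    [t]. *)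
Lemma reduced_catrev s t :
  reduced s -> reduced t ->
  (if (s, t) is (x :: _, _ :: z :: _) then x != z else true) ->
  (if (s, t) is (_ :: y :: _, z :: _) then y != z else true) ->
  reduced (catrev s t).
Proof.
elim: s t => // x s IH t /= /andP[xs rs] rt h1 h2; apply: IH => //=.
- by rewrite rt andbT; case: t h1 {rt h2} => [|a [|b t]].
- by case: s xs {rs h2} => [|a [|b s]] //; rewrite eq_sym.
Qed.

Hypotheses (e_sym : symmetric e) (e_irr : irreflexive e).
Hypothesis girth9 : girth_at_least e 9.

(** A return to [x] would close a cycle: length 1 is excluded by irreflexivity, length 2 by
    [reduced], lengths 3 to 8 by the girth. *)
Lemma reduced_path_uniq x p :
  path e x p -> reduced (x :: p) -> size p <= 8 -> uniq (x :: p).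
Proof.
elim: p x => // y p IH x xp rp sp.
have uyp : uniq (y :: p).
  by apply: IH; [case/andP: xp | exact: reduced_tail rp | exact: ltnW].
rewrite cons_uniq uyp andbT; apply/negP => x_p.
case/splitPr def_p: {1}(y :: p) / x_p => [p1 p2].
rewrite def_p in xp rp uyp sp.
have xp1 : path e x (rcons p1 x).
  by move: xp; rewrite cat_path rcons_path /= => /and3P[-> ->].
have up1 : uniq (x :: p1).
  by move: uyp; rewrite -cat_rcons cat_uniq rcons_uniq => /andP[].
have sp1 : size p1 < 8.
  by move: sp; rewrite size_cat /= addnS; apply: leq_trans; rewrite ltnS leq_addr.
case: p1 xp1 up1 sp1 rp {def_p xp uyp sp} => [|a [|b p1]].
- by rewrite /= e_irr.
- by rewrite /= eqxx.
move=> xp1 up1 sp1 _; have /girth_at_leastP := girth9.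
by move/(_ (x :: a :: b :: p1) isT); rewrite /ucycle up1 andbT => /(_ xp1); rewrite leqNgt ltnS sp1.
Qed.

(** Once common first vertices are removed, reversing one path and appending the other gives a
    non-backtracking closed walk of length at most 8. *)
Lemma short_path_unique x p q :
  path e x p -> path e x q -> reduced (x :: p) -> reduced (x :: q) ->
  last x p = last x q -> size p + size q <= 8 -> p = q.
Proof.
elim: p x q => [|y p IH] x [|z q] xp xq rp rq eqpq spq //.
- have := reduced_path_uniq xq rq spq.
  by rewrite cons_uniq; have /= -> := eqpq; rewrite mem_last.
- rewrite addn0 in spq; have := reduced_path_uniq xp rp spq.
  by rewrite cons_uniq; have /= {1}<- := eqpq; rewrite mem_last.
have [eq_yz|y'z] := eqVneq y z.
  rewrite -eq_yz in xq rq eqpq *; congr (_ :: _); apply: (IH y) => //.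
  - by case/andP: xp.
  - by case/andP: xq.
  - exact: reduced_tail rp.
  - exact: reduced_tail rq.
  - by move: spq; rewrite /= addSn addnS => /ltnW/ltnW.
set a := last x (y :: p).
have revE : catrev (x :: y :: p) (z :: q)
    = a :: (rev (belast x (y :: p)) ++ z :: q).
  by rewrite catrevE lastI rev_rcons.
have pa : path e a (rev (belast x (y :: p)) ++ z :: q).
  rewrite cat_path rev_path (eq_path (e' := e)); last by move=> u v; rewrite e_sym.
  rewrite xp; move: xq; congr (path e _ _).
  by rewrite /= rev_cons last_rcons.
have ra : reduced (a :: (rev (belast x (y :: p)) ++ z :: q)).
  rewrite -revE; apply: reduced_catrev; rewrite ?y'z //.
  - exact: reduced_tail rq.
  - by case: (q) rq => //= ? ? /andP[].
have sa : size (rev (belast x (y :: p)) ++ z :: q) <= 8.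
  by rewrite size_cat size_rev size_belast.
have := reduced_path_uniq pa ra sa.
rewrite cons_uniq mem_cat; suff -> : a \in z :: q by rewrite orbT.
by rewrite (eqpq : a = last z q) mem_last.
Qed.

Lemma edge_neq x y : e x y -> x != y.
Proof. by apply: contraTneq => ->; rewrite e_irr. Qed.

Lemma in_notin_neq (W : {set T}) x y : x \in W -> y \notin W -> x != y.
Proof. by move=> xW; apply: contraNneq => <-. Qed.

Ltac adj := solve [assumption | rewrite e_sym; assumption].
Ltac neq := solve [assumption | rewrite eq_sym; assumption
  | match goal with
    | H1 : is_true (?x \in ?W), H2 : is_true (?y \notin ?W) |- is_true (?x != ?y) =>
        exact: (in_notin_neq H1 H2)
    | H1 : is_true (?y \in ?W), H2 : is_true (?x \notin ?W) |- is_true (?x != ?y) =>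
        rewrite eq_sym; exact: (in_notin_neq H1 H2)
    end
  | apply: edge_neq; adj].
Ltac side := try done; repeat (apply/andP; split); try done; first [adj | neq].
Ltac two_paths x p q :=
  have: p = q by apply: (short_path_unique (x := x)); rewrite //=; side.

Ltac clash :=
  match goal with
  | H1 : is_true (?a \in ?W), H2 : is_true (?a \notin ?W) |- _ => by rewrite H1 in H2
  | H : is_true (?a != ?a) |- _ => by rewrite eqxx in H
  end.
(** Two short paths from [x] to the same end must be equal, but the given lists differ in length or
    at vertices that the context separates. *)
Ltac no_two_paths x p q :=
  exfalso; two_paths x p q; let E := fresh "E" in intro E;
  first [discriminate E | injection E; intros; subst; clash].

(** * Colouring the closed neighbourhood of a set *)

Section Links.
Variable W : {set T}.

(* Colours are elements of [W], each [w \in W] being its own colour; [links2 w]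
   are the neighbours of [w] outside [W] that have a second neighbour in [W]. *)
Definition links2 (w : T) : {set T} :=
  [set x | [&& x \notin W, e x w & [exists w' in W, (w' != w) && e x w']]].

Definition reach (x z : T) : bool :=
  (z \in W) && [exists y, [&& y \notin W, e x y & e y z]].

Definition link (x : T) : bool :=
  (x \notin W) && [exists w in W, e x w && ((x \in links2 w) || [exists z, reach x z])].

Definition lone (x : T) : bool :=
  [&& x \notin W, ~~ [exists z, reach x z], [exists w in W, e x w] &
    [forall w in W, e x w ==> (links2 w == [set x])]].

Definition neighbor_link (u x : T) : bool :=
  [&& x \notin W, x != u, [exists w in W, e u w && e x w] & [exists z, reach x z]].

(** The same [pick] as in [link_color], so that a lone link swaps with at most one partner. *)
Definition swapped (u x : T) : bool :=
  lone u && ([pick s | neighbor_link u s] == Some x).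

Definition far_end (w x : T) : T := odflt w [pick z in W | e x z && (z != w)].

(* If [e w z], a link at [w] with colour [z] wastes a neighbour of [w]; this is
   harmless as soon as [w] has a neighbour to spare. *)
Definition avoidable (x z : T) : bool :=
  ~~ e x z && [forall w in W, e x w && e w z ==> (#|W| <= degree e w)].

(* A link takes a vertex of [W] that it reaches in two steps through the outside
   of [W] if there is one.  Otherwise it has two neighbours in [W] and takes a
   vertex of [W] beyond another link at one of them, the choice of the other
   link being a cyclic shift so that no two links make the same choice.  A lone
   link [u] that finds no such partner takes what a link [s] next to it would
   have taken, while [s] takes a vertex beyond [u]; failing this too, [u] is the
   only link at each of its neighbours in [W] and the encirclement hypothesis
   gives a colour. *)
Definition link_color (x : T) : T :=
  if [pick z | reach x z] is Some z then
    if [pick u | swapped u x] is Some u then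
      far_end (odflt x [pick w in W | e x w && e u w]) u
    else z
  else if [pick w in W | e x w && (links2 w != [set x])] is Some w then
    far_end w (next (enum (links2 w)) x)
  else if [pick s | neighbor_link x s] is Some s then odflt x [pick z | reach s z]
  else odflt x [pick z in W | avoidable x z].

(** Records how [u] was chosen, in enough detail to recover [x] from [w] and [u]. *)
Definition detour (x w u : T) : bool :=
  if x \in links2 w then (u == next (enum (links2 w)) x)
  else swapped u x && (links2 w == [set u]).

(** The first three constructors carry a path from [x] to its colour, of length 2, 3 and 4;
    coinciding colours then yield two short paths. *)
Variant link_color_spec (x z : T) : Prop :=
| ReachColor y of (forall u, ~~ swapped u x) & y \notin W & e x y & e y z
| DetourColor w u of w \in W & e x w & u \notin W & e u w & u != x &
    e u z & z != w & detour x w u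
| LoneColor s w y of lone x & swapped x s & s \notin W & s != x & w \in W &
    e x w & e s w & y \notin W & e s y & e y z
| FreeColor of lone x & (forall s, ~~ neighbor_link x s) & avoidable x z.

Hypothesis avoidable_ex : forall u, u \notin W -> exists2 z, z \in W & avoidable u z.

Lemma far_endP w u : u \in links2 w ->
  [/\ far_end w u \in W, e u (far_end w u) & far_end w u != w].
Proof.
rewrite inE => /and3P[_ _ /exists_inP[z zW /andP[zw uz]]].
rewrite /far_end; case: pickP => [a /= /and3P[] // |/(_ z)].
by rewrite /= zW uz zw.
Qed.

Lemma next_neq (s : seq T) x y : uniq s -> x \in s -> y \in s -> y != x -> next s x != x.
Proof.
move=> us xs ys yx; have [i s' def_s] := rot_to xs.
move: us ys; rewrite -(rot_uniq i) -(mem_rot i) def_s.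
move=> us; rewrite -(next_rot i); last by move: us; rewrite -def_s rot_uniq.
rewrite def_s; case: s' us {def_s} => [|a s'] /=.
  by rewrite inE (negPf yx).
by rewrite eqxx !inE negb_or eq_sym => /andP[/andP[]].
Qed.

Lemma lone_links2 x w : lone x -> w \in W -> e x w -> links2 w = [set x].
Proof.
case/and4P=> _ _ _ /forall_inP lx wW xw; apply/eqP.
by move/implyP: (lx w wW); apply.
Qed.

Lemma swapped_neighbor u x : swapped u x -> neighbor_link u x.
Proof. by case/andP=> _ /eqP; case: pickP => // s us [<-]. Qed.

Lemma link_colorP x : link x -> link_color x \in W /\ link_color_spec x (link_color x).
Proof.
case/andP=> xW /exists_inP[w wW /andP[xw w_link]].
rewrite /link_color; case: pickP => [z xz|no_reach].
  case: pickP => [u sux|no_swap]; last first.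
    case/andP: xz => zW /existsP[y /and3P[yW xy yz]].
    by split=> //; apply: ReachColor xy yz => // u; rewrite no_swap.
  have lu : lone u by case/andP: sux.
  case/and4P: (swapped_neighbor sux) => _ xu /exists_inP[w1 w1W /andP[uw1 xw1]] _.
  case: pickP => [w2 /and3P[w2W xw2 uw2] /=|/(_ w1)]; last by rewrite /= w1W xw1 uw1.
  have defL := lone_links2 lu w2W uw2.
  have uL : u \in links2 w2 by rewrite defL inE.
  have [zW uz zw2] := far_endP uL.
  split=> //; apply: (DetourColor w2W xw2 _ uw2 _ uz zw2) => //.
  - by case/andP: lu.
  - by rewrite eq_sym.
  by rewrite /detour defL inE (negPf xu) eqxx andbT.
have xL : x \in links2 w by case/orP: w_link => // /existsP[z]; rewrite no_reach.
case: pickP => [w1 /and3P[w1W xw1 w1L]|lx].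
  have xL1 : x \in links2 w1.
    rewrite inE xW xw1 /=; apply/exists_inP.
    have [->|w'w1] := eqVneq w1 w; last by exists w; rewrite // eq_sym w'w1.
    by move: xL; rewrite inE => /and3P[_ _ /exists_inP].
  set u := next _ x.
  have uL : u \in links2 w1 by rewrite -(mem_enum (links2 w1)) mem_next mem_enum.
  have [zW uz zw1] := far_endP uL.
  have /and3P[uW uw1 _] : [&& u \notin W, e u w1 & true].
    by move: uL; rewrite inE => /and3P[-> ->].
  (* [links2 w1] has an element other than [x], so the cyclic shift moves [x]. *)
  have ux : u != x.
    have [y yL yx] : exists2 y, y \in links2 w1 & y != x.
      apply/exists_inP; apply: contraR w1L => /exists_inPn no_y; apply/eqP/setP => y.
      rewrite inE; apply/idP/eqP => [/no_y/negPn/eqP //|-> //].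
    by apply: (next_neq (y := y)); rewrite ?enum_uniq ?mem_enum.
  by split=> //; apply: (DetourColor w1W xw1 uW uw1 ux uz zw1); rewrite /detour xL1.
have {}lx : lone x.
  rewrite /lone xW /=; apply/and3P; split.
  - by apply/existsPn => z; rewrite no_reach.
  - by apply/exists_inP; exists w.
  by apply/forall_inP => w' w'W; apply/implyP => xw'; have := lx w'; rewrite /= w'W xw' => /negbFE.
case partner: [pick s | _] => [s|].
  have sxs : swapped x s by rewrite /swapped lx partner eqxx.
  case/and4P: (swapped_neighbor sxs) => sW sx /exists_inP[w1 w1W /andP[xw1 sw1]] s_reach.
  case: pickP => [z /andP[zW /existsP[y /and3P[yW sy yz]]]|no_z]; last first.
    by case/existsP: s_reach => z; rewrite no_z.
  by split=> //; apply: (LoneColor lx sxs sW sx w1W xw1 sw1 yW sy yz).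
have no_s : forall s, ~~ neighbor_link x s.
  by move: partner; case: pickP => // no_s _ s; rewrite no_s.
have [z zW xz] := avoidable_ex xW.
case: pickP => [z' /andP[z'W xz']|/(_ z)]; last by rewrite /= zW xz.
by split=> //; apply: FreeColor.
Qed.

Lemma link_notin x : link x -> x \notin W.
Proof. by case/andP. Qed.

Lemma link_color_in x : link x -> link_color x \in W.
Proof. by case/link_colorP. Qed.

Lemma link_color_nadj x : link x -> ~~ e x (link_color x).
Proof.
move=> lx; have xW := link_notin lx; have [] := link_colorP lx.
move: (link_color x) => z zW spec; apply/negP => xz.
case: spec => [y _ yW xy yz|w u wW xw uW uw ux uz zw _
  |s w y _ _ sW sx wW xw sw yW sy yz|_ _ /andP[/negP]] //.
- no_two_paths x [:: y; z] [:: z].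
- no_two_paths x [:: w; u; z] [:: z].
- no_two_paths x [:: w; s; y; z] [:: z].
Qed.

Lemma adj_links_reach x x' : x \notin W -> link x' -> e x x' -> [exists z, reach x z].
Proof.
move=> xW /andP[x'W /exists_inP[w wW /andP[xw _]]] xx'.
by apply/existsP; exists w; rewrite /reach wW; apply/existsP; exists x'; rewrite x'W xx'.
Qed.

(** Each of two adjacent links reaches [W] through the other, so neither is lone and only colours at
    the end of paths of length 2 or 3 occur. *)
Lemma link_color_adj x x' : link x -> link x' -> e x x' ->
  link_color x != link_color x'.
Proof.
move=> lx lx' xx'; apply/eqP => eq_z.
have xW := link_notin lx; have x'W := link_notin lx'.
have nlx : ~~ lone x by rewrite /lone (adj_links_reach xW lx' xx') !andbF.
have nlx' : ~~ lone x'.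
  by rewrite /lone (adj_links_reach x'W lx) ?andbF // e_sym.
have nxz := link_color_nadj lx; have nxz' := link_color_nadj lx'.
have [_ spec'] := link_colorP lx'; have [zW spec] := link_colorP lx.
rewrite -{}eq_z in nxz' spec'; move: (link_color x) zW nxz nxz' spec spec'.
move=> z zW nxz nxz'.
case=> [y _ yW xy yz|w u wW xw uW uw ux uz zw _|? ? ? /(negP nlx)|/(negP nlx)] //.
  case=> [y' _ y'W x'y' y'z|w' u' w'W x'w' u'W u'w' u'x' u'z zw' _
    |? ? ? /(negP nlx')|/(negP nlx')] //.
  - have y'x : y' != x by apply: contraNneq nxz => <-.
    no_two_paths x [:: y; z] [:: x'; y'; z].
  - no_two_paths x [:: y; z] [:: x'; w'; u'; z].
case=> [y' _ y'W x'y' y'z|w' u' w'W x'w' u'W u'w' u'x' u'z zw' _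
    |? ? ? /(negP nlx')|/(negP nlx')] //.
- have y'x : y' != x by apply: contraNneq nxz => <-.
  no_two_paths x [:: w; u; z] [:: x'; y'; z].
- no_two_paths x [:: w; u; z] [:: x'; w'; u'; z].
Qed.

(** [next] is invertible and swap partners are unique; the mixed case would make [links2 w] equal to
    [[set u]] while containing another link. *)
Lemma detour_inj x x' w u : x \notin W -> x' \notin W -> u != x -> u != x' ->
  detour x w u -> detour x' w u -> x = x'.
Proof.
move=> xW x'W ux ux'; rewrite /detour; case: ifP => xL; case: ifP => x'L.
- move=> /eqP-> /eqP/(congr1 (prev (enum (links2 w)))).
  by rewrite !prev_next ?enum_uniq.
- by move=> _ /andP[_ /eqP Lu]; move: xL; rewrite Lu inE eq_sym (negPf ux).
- by move=> /andP[_ /eqP Lu] _; move: x'L; rewrite Lu inE eq_sym (negPf ux').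
- by move=> /andP[/andP[_ /eqP ps] _] /andP[/andP[_ /eqP]]; rewrite ps => -[].
Qed.

(** Since [links2 w0] is [[set x]], the vertex [x'] has no second neighbour in [W] and can be a link
    only by reaching [W] in two steps. *)
Lemma lone_neighbor_link x x' w0 : lone x -> w0 \in W -> e w0 x ->
  link x' -> e w0 x' -> x' != x -> neighbor_link x x'.
Proof.
move=> lox w0W wx lx' wx' x'x; have x'W := link_notin lx'.
have x'L : x' \notin links2 w0 by rewrite (lone_links2 lox w0W) ?inE // e_sym.
rewrite /neighbor_link x'W x'x /=; apply/andP; split.
  by apply/exists_inP; exists w0; rewrite // e_sym wx e_sym.
case/andP: lx' => _ /exists_inP[w wW /andP[x'w /orP[x'Lw|//]]].
case/negP: x'L; have [<- //|w'w0] := eqVneq w w0.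
by rewrite inE x'W e_sym wx' /=; apply/exists_inP; exists w; rewrite // w'w0.
Qed.

(** Equal colours give two paths from [w0]. The extreme lengths are 4 and 4, or 5 and 3: the full
    total of 8 that the girth allows. *)
Lemma link_color_share x x' w0 : link x -> link x' -> x != x' -> w0 \in W ->
  e w0 x -> e w0 x' -> link_color x != link_color x'.
Proof.
wlog le_xx': x x' / lone x' -> lone x.
  move=> IH lx lx' xx' w0W wx wx'; case: (boolP (lone x')) => [lox'|nlox'].
    by rewrite eq_sym; apply: IH => //; rewrite eq_sym.
  by apply: IH => //; move/(negP nlox').
move=> lx lx' xx' w0W wx wx'; apply/eqP => eq_z.
have x'x : x' != x by rewrite eq_sym.
have xW := link_notin lx; have x'W := link_notin lx'.
have xL' : lone x -> x' \notin links2 w0.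
  by move=> lox; rewrite (lone_links2 lox w0W) ?inE // e_sym.
have nlx' : ~~ lone x'.
  apply/negP => lox'; have lox := le_xx' lox'; have := xL' lox.
  by rewrite (lone_links2 lox') ?inE ?eqxx // e_sym.
have nxz := link_color_nadj lx; have nxz' := link_color_nadj lx'.
have [_ spec'] := link_colorP lx'; have [zW spec] := link_colorP lx.
rewrite -{}eq_z in nxz' spec'; move: (link_color x) zW nxz nxz' spec spec'.
move=> z zW nxz nxz'.
case=> [y nswx yW xy yz|w u wW xw uW uw ux uz zw dxw
  |s w y lox xs sW sx wW xw sw yW sy yz|lox no_s _].
- case=> [y' nswx' y'W x'y' y'z|w' u' w'W x'w' u'W u'w' u'x' u'z zw' dxw'
    |? ? ? /(negP nlx')|/(negP nlx')] //.
    no_two_paths w0 [:: x; y; z] [:: x'; y'; z].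
  have [eq_w|w0w'] := eqVneq w' w0.
    subst w'; no_two_paths w0 [:: x; y; z] [:: u'; z].
  no_two_paths w0 [:: x; y; z] [:: x'; w'; u'; z].
- case=> [y' nswx' y'W x'y' y'z|w' u' w'W x'w' u'W u'w' u'x' u'z zw' dxw'
    |? ? ? /(negP nlx')|/(negP nlx')] //.
    have [eq_w|w0w] := eqVneq w w0.
      subst w; no_two_paths w0 [:: x'; y'; z] [:: u; z].
    no_two_paths w0 [:: x'; y'; z] [:: x; w; u; z].
  have [eq_w|w0w] := eqVneq w w0; have [eq_w'|w0w'] := eqVneq w' w0.
  + subst w w'; have [eq_u|u'u] := eqVneq u' u.
      subst u'; case/eqP: xx'; exact: detour_inj dxw dxw'.
    no_two_paths w0 [:: u; z] [:: u'; z].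
  + subst w; no_two_paths w0 [:: u; z] [:: x'; w'; u'; z].
  + subst w'; no_two_paths w0 [:: x; w; u; z] [:: u'; z].
  + no_two_paths w0 [:: x; w; u; z] [:: x'; w'; u'; z].
- case=> [y' nswx' y'W x'y' y'z|w' u' w'W x'w' u'W u'w' u'x' u'z zw' dxw'
    |? ? ? /(negP nlx')|/(negP nlx')] //.
    (* The partner [s] of [x] has given up the colour it reaches, whereas [x'] keeps its own. *)
    have sx' : s != x' by apply: contraNneq (nswx' x) => <-.
    have [eq_w|w0w] := eqVneq w w0.
      subst w; no_two_paths w0 [:: s; y; z] [:: x'; y'; z].
    no_two_paths w0 [:: x; w; s; y; z] [:: x'; y'; z].
  have eq_w' : w' = w0.
    apply: contraNeq (xL' lox) => w'w0; rewrite inE x'W e_sym wx' /=.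
    by apply/exists_inP; exists w'; rewrite // w'w0.
  (* As [x'] is not in [links2 w0], its detour runs through the lone link there, [x] itself, whose
     colour would then be adjacent to it. *)
  subst w'; move: dxw'; rewrite /detour (negPf (xL' lox)) => /andP[_].
  rewrite (lone_links2 lox) 1?e_sym // => /eqP/set1_inj eq_xu'; subst u'.
  by rewrite u'z in nxz.
- by case/negP: (no_s x'); apply: lone_neighbor_link lox w0W wx lx' wx' x'x.
Qed.

(** Only a freely chosen colour can be adjacent to [w0]. Then [avoidable] gives the spare neighbour,
    and any other link at [w0] would have been a partner for [x]. *)
Lemma link_color_repeat x w0 : link x -> w0 \in W -> e w0 x -> e w0 (link_color x) ->
  #|W| <= degree e w0 /\ (forall x', link x' -> e w0 x' -> x' = x).
Proof.
move=> lx w0W wx; have xW := link_notin lx; have nxz := link_color_nadj lx.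
have [] := link_colorP lx; move: (link_color x) nxz => z nxz zW spec wz.
case: spec => [y nswx yW xy yz|w u wW xw uW uw ux uz zw dxw
  |s w y lox xs sW sx wW xw sw yW sy yz|lox no_s /andP[_ /forall_inP slack]].
- no_two_paths w0 [:: x; y; z] [:: z].
- have [eq_w|w0w] := eqVneq w w0.
    subst w; no_two_paths w0 [:: u; z] [:: z].
  no_two_paths w0 [:: x; w; u; z] [:: z].
- have [eq_w|w0w] := eqVneq w w0.
    subst w; no_two_paths w0 [:: s; y; z] [:: z].
  no_two_paths w0 [:: x; w; s; y; z] [:: z].
split; first by have := slack w0 w0W; rewrite e_sym wx wz.
move=> x' lx' wx'; apply: contraNeq (no_s x') => x'x.
exact: lone_neighbor_link lox w0W wx lx' wx' x'x.
Qed.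

(** * Supplying the missing colours *)

Definition nonlinks (w : T) : {set T} := [set x | [&& x \notin W, e w x & ~~ link x]].

Definition missing (w : T) : {set T} :=
  W :\: (w |: ([set z in W | e w z] :|: link_color @: [set x | link x && e w x])).

(** Without repetition, the neighbours of [w] in [W] and its links show distinct colours other than
    [w], and the degree bound suffices. A repetition wastes just one neighbour, which the larger
    degree pays for. *)
Lemma card_missing w : w \in W -> #|W|.-1 <= degree e w -> #|missing w| <= #|nonlinks w|.
Proof.
move=> wW deg_w; set NW := [set z in W | e w z]; set L := [set x | link x && e w x].
have degE : degree e w = #|NW| + (#|L| + #|nonlinks w|).
  rewrite /degree -(cardsID W); congr (_ + _).
    by apply: eq_card => x; rewrite !inE andbC.
  rewrite -(cardsID [set x | link x]); congr (_ + _); apply: eq_card => x; rewrite !inE.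
    have [lx|] := boolP (link x); last by rewrite andbF.
    by rewrite (link_notin lx) andbT.
  by rewrite andbC -andbA.
have SW : w |: (NW :|: link_color @: L) \subset W.
  apply/subsetP => z; rewrite !inE => /or3P[/eqP-> //|/andP[] //|/imsetP[x]].
  by rewrite inE => /andP[lx _] ->; rewrite link_color_in.
have wNW : w \notin NW by rewrite inE e_irr andbF.
have missingE : #|missing w| = #|W| - #|w |: (NW :|: link_color @: L)|.
  by rewrite cardsD (setIidPr SW).
have [/exists_inP[x]|/exists_inPn no_repeat] := boolP [exists x in L, e w (link_color x)].
  rewrite inE => /andP[lx wx] wz; have [W_deg uniq_x] := link_color_repeat lx wW wx wz.
  have L1 : #|L| <= 1.
    rewrite -(cards1 x) subset_leq_card //; apply/subsetP => x'; rewrite !inE.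
    by case/andP=> lx' wx'; rewrite (uniq_x x').
  have S1 : #|NW|.+1 <= #|w |: (NW :|: link_color @: L)|.
    have <- : #|w |: NW| = #|NW|.+1 by rewrite cardsU1 wNW.
    by rewrite subset_leq_card // setUS // subsetUl.
  rewrite missingE leq_subLR (leq_trans W_deg) // degE.
  rewrite addnA leq_add2r (leq_trans _ S1) // -addn1 leq_add2l //.
have wPhi : w \notin NW :|: link_color @: L.
  rewrite inE (negPf wNW); apply/imsetP => -[x]; rewrite inE => /andP[lx wx] eq_w.
  by have := link_color_nadj lx; rewrite -eq_w e_sym wx.
have disj : [disjoint NW & link_color @: L].
  rewrite disjoint_sym disjoints_subset; apply/subsetP => z /imsetP[x xL ->].
  by rewrite !inE negb_and no_repeat ?orbT.
have injL : {in L &, injective link_color}.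
  move=> x x'; rewrite !inE => /andP[lx wx] /andP[lx' wx'] eq_z.
  apply/eqP; apply: contraTT isT => xx'.
  by have := link_color_share lx lx' xx' wW wx wx'; rewrite eq_z eqxx.
rewrite missingE cardsU1 wPhi cardsU disjoint_setI0 // cards0 subn0 card_in_imset //.
by rewrite leq_subLR -addnA -addnA -degE; move: deg_w; case: #|W|.
Qed.

Hypothesis W_gt1 : 1 < #|W|.
Hypothesis W_deg : forall w, w \in W -> #|W|.-1 <= degree e w.

Definition closed_nbhd : {set T} := [set x | (x \in W) || [exists w in W, e x w]].

(** A filler colour for nonlinks of [w] in excess of its missing colours. *)
Definition other (w : T) : T := odflt w [pick z in W | z != w].

Lemma otherP w : other w \in W /\ other w != w.
Proof.
rewrite /other; case: pickP => [z /andP[] //|no_z].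
move: W_gt1; rewrite ltnNge -(cards1 w) subset_leq_card //.
by apply/subsetP => z zW; rewrite inE; have := no_z z; rewrite /= zW => /negbFE.
Qed.

(** The [pick] is forced: a nonlink in the closed neighbourhood has one neighbour in [W], as two
    would make it a link. *)
Definition nbhd_color (x : T) : T :=
  if x \in W then x else if link x then link_color x else
  if [pick w in W | e x w] is Some w then
    nth (other w) (enum (missing w)) (index x (enum (nonlinks w)))
  else x.

Lemma nonlink_colorP x w : x \in nonlinks w -> w \in W ->
  nbhd_color x = nth (other w) (enum (missing w)) (index x (enum (nonlinks w))).
Proof.
rewrite inE /nbhd_color => /and3P[xW wx nlx] wW; rewrite (negPf xW) (negPf nlx).
case: pickP => [w' /andP[w'W xw']|/(_ w)]; last by rewrite /= wW e_sym wx.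
suff -> : w' = w by [].
apply: contraNeq nlx => w'w; rewrite /link xW; apply/exists_inP; exists w => //.
rewrite inE xW [e x w]e_sym wx /=; apply/orP; left.
by apply/exists_inP; exists w'; rewrite // w'w.
Qed.

Lemma nbhd_color_id w : w \in W -> nbhd_color w = w.
Proof. by rewrite /nbhd_color => ->. Qed.

Lemma nbhd_color_link x : link x -> nbhd_color x = link_color x.
Proof. by move=> lx; rewrite /nbhd_color (negPf (link_notin lx)) lx. Qed.

Lemma missingP w z :
  reflect [/\ z \in W, z != w, ~~ e w z &
             forall x, link x -> e w x -> link_color x != z] (z \in missing w).
Proof.
rewrite !inE negb_or andbC; apply: (iffP and3P) => [[zW zw]|[zW zw wz no_x]].
  rewrite zW negb_or /= => /andP[wz no_x]; split=> // x lx wx.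
  by apply: contraNneq no_x => <-; rewrite imset_f // inE lx.
rewrite zW zw negb_or wz; split=> //=; apply/imsetP => -[x]; rewrite inE => /andP[lx wx] eq_z.
by have := no_x x lx wx; rewrite eq_z eqxx.
Qed.

Lemma nonlink_color x w : x \in nonlinks w -> w \in W ->
  nbhd_color x \in W /\ nbhd_color x != w.
Proof.
move=> xQ wW; rewrite (nonlink_colorP xQ wW).
have [lt_x|ge_x] := ltnP (index x (enum (nonlinks w))) (size (enum (missing w))).
  have := mem_nth (other w) lt_x; rewrite mem_enum => /missingP[zW zw _ _].
  by split.
by rewrite nth_default //; exact: otherP.
Qed.

Lemma closed_nbhdP x : x \in closed_nbhd ->
  [\/ x \in W, link x | exists2 w, w \in W & x \in nonlinks w].
Proof.
rewrite inE => /orP[xW|/exists_inP[w wW xw]]; first by constructor 1.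
have [xW|xW] := boolP (x \in W); first by constructor 1.
have [lx|nlx] := boolP (link x); first by constructor 2.
by constructor 3; exists w; rewrite // inE xW e_sym xw nlx.
Qed.

Lemma nbhd_color_in x : x \in closed_nbhd -> nbhd_color x \in W.
Proof.
case/closed_nbhdP => [xW|lx|[w wW xQ]]; first by rewrite nbhd_color_id.
  by rewrite nbhd_color_link // link_color_in.
by case: (nonlink_color xQ wW).
Qed.

(** On an edge outside [W], each end reaches a neighbour in [W] of the other, so both are links; a
    nonlink only has to differ from its neighbour in [W]. *)
Lemma nbhd_color_proper x y : x \in closed_nbhd -> y \in closed_nbhd -> e x y ->
  nbhd_color x != nbhd_color y.
Proof.
have inW a b : a \in W -> b \in closed_nbhd -> e a b -> nbhd_color a != nbhd_color b.
  move=> aW bN ab; rewrite nbhd_color_id //.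
  case/closed_nbhdP: bN => [bW|lb|[w wW bQ]].
  - by rewrite nbhd_color_id // edge_neq.
  - rewrite nbhd_color_link //; apply: contraTneq ab => ->.
    by rewrite e_sym link_color_nadj.
  suff -> : a = w by rewrite eq_sym; case: (nonlink_color bQ wW).
  move: bQ; rewrite inE => /and3P[bW wb]; apply: contraNeq => aw.
  rewrite /link bW; apply/exists_inP; exists w; rewrite // inE bW [e b w]e_sym wb /=.
  by apply/orP; left; apply/exists_inP; exists a; rewrite // aw e_sym.
move=> xN yN xy; have [xW|xW] := boolP (x \in W); first exact: inW.
have [yW|yW] := boolP (y \in W); first by rewrite eq_sym inW // e_sym.
have lnk a b : a \notin W -> b \notin W -> a \in closed_nbhd -> b \in closed_nbhd ->
    e a b -> link a.
  move=> aW bW; rewrite !inE (negPf aW) (negPf bW) /= => /exists_inP[w wW aw].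
  move=> /exists_inP[w' w'W bw'] ab; rewrite /link aW; apply/exists_inP; exists w => //.
  rewrite aw; apply/orP; right; apply/existsP; exists w'; rewrite /reach w'W.
  by apply/existsP; exists b; rewrite bW ab.
have lx := lnk _ _ xW yW xN yN xy.
have ly : link y by apply: (lnk y x); rewrite // e_sym.
by rewrite !nbhd_color_link // link_color_adj.
Qed.

Lemma nbhd_color_onto w z : w \in W -> z \in W -> z != w ->
  exists x, [/\ e w x, x \in closed_nbhd & nbhd_color x = z].
Proof.
move=> wW zW zw.
have inN x : e w x -> x \in closed_nbhd.
  by rewrite inE => wx; apply/orP; right; apply/exists_inP; exists w; rewrite // e_sym.
suff [x wx xz] : exists2 x, e w x & nbhd_color x = z by exists x; rewrite inN.
have [wz|nwz] := boolP (e w z); first by exists z; rewrite ?nbhd_color_id.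
have [/existsP[x /and3P[lx wx /eqP xz]]|/existsPn no_x] :=
    boolP [exists x, [&& link x, e w x & link_color x == z]].
  by exists x; rewrite ?nbhd_color_link.
have zM : z \in missing w.
  apply/missingP; split=> // x lx wx.
  by have := no_x x; rewrite lx wx.
have lt_z : index z (enum (missing w)) < size (enum (nonlinks w)).
  rewrite -cardE (leq_trans _ (card_missing wW (W_deg wW))) //.
  by rewrite [#|missing w|]cardE index_mem mem_enum.
set x := nth w (enum (nonlinks w)) (index z (enum (missing w))).
have xQ : x \in nonlinks w by rewrite -mem_enum mem_nth.
exists x; first by move: xQ; rewrite inE => /and3P[].
by rewrite (nonlink_colorP xQ wW) index_uniq ?enum_uniq // nth_index ?mem_enum.
Qed.
End Links.

(** * From partial to total colourings *)

(** Induction on the number of uncoloured vertices. *)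
Lemma greedy_extension (W A : {set T}) (f : T -> T) :
  {in A, forall x, f x \in W} ->
  {in A &, forall x y, e x y -> f x != f y} ->
  (forall x, x \notin A -> degree e x < #|W|) ->
  exists g : T -> T, [/\ forall x, g x \in W, forall x y, e x y -> g x != g y
    & {in A, g =1 f}].
Proof.
elim: {A}#|~: A| {-2}A f (erefl #|~: A|) => [|n IH] A f cA fW fP lowdeg.
  have inA x : x \in A.
    by move/eqP: cA; rewrite cards_eq0 => /eqP/setP/(_ x); rewrite !inE => /negbFE.
  by exists f; split=> // [x|x y]; [exact: fW | exact: fP].
have /card_gt0P[x] : 0 < #|~: A| by rewrite cA.
rewrite inE => xA.
(* All neighbours are avoided, even those outside [A], whose [f]-values are meaningless; they are
   still fewer than [#|W|]. *)
have [c cW c_new] : exists2 c, c \in W & c \notin f @: [set y | e x y].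
  apply/exists_inP; apply: contraTT (lowdeg x xA) => /exists_inPn no_c.
  rewrite -leqNgt (leq_trans _ (leq_imset_card f _)) // subset_leq_card //.
  by apply/subsetP => c /no_c/negPn.
pose f' y := if y == x then c else f y.
have f'E y : y \in A -> f' y = f y.
  by rewrite /f'; case: eqP => // ->; rewrite (negPf xA).
have c_neq y : e x y -> c != f y.
  by move=> xy; apply: contraNneq c_new => ->; rewrite imset_f // inE.
have [| | | |g [gW gP gE]] := IH (x |: A) f'.
- by apply: succn_inj; rewrite -cA [in RHS](cardsD1 x) !inE xA setCU setDE setIC.
- by move=> y; rewrite !inE /f'; case: eqP => //= _; apply: fW.
- move=> y z; rewrite !inE /f'; case: eqP => [->|_]; case: eqP => [->|_] //=.
  + by rewrite e_irr.
  + by move=> _ _; apply: c_neq.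
  + by move=> _ _ yx; rewrite eq_sym c_neq // e_sym.
  + exact: fP.
- by move=> y; rewrite !inE negb_or => /andP[_ /lowdeg].
by exists g; split=> // y yA; rewrite gE ?f'E // !inE yA orbT.
Qed.

Lemma good_set_has_b_coloring (W : {set T}) : 1 < #|W| ->
  (forall w, w \in W -> #|W|.-1 <= degree e w) ->
  (forall x, x \notin closed_nbhd W -> degree e x < #|W|) ->
  (forall u, u \notin W -> exists2 z, z \in W & avoidable W u z) ->
  has_b_coloring e #|W|.
Proof.
move=> W_gt1 W_deg lowdeg avoid.
have [g [gW gP gE]] : exists g : T -> T, [/\ forall x, g x \in W,
    forall x y, e x y -> g x != g y & {in closed_nbhd W, g =1 nbhd_color W}].
  apply: greedy_extension lowdeg.
  - exact: nbhd_color_in.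
  - by move=> x y; apply: nbhd_color_proper.
have gid w : w \in W -> g w = w.
  by move=> wW; rewrite gE ?nbhd_color_id // inE wW.
have [w0 w0W] : exists w, w \in W by apply/card_gt0P; apply: ltnW.
pose rk := enum_rank_in w0W.
have rkK : {in W, cancel rk enum_val} by move=> w wW; apply: enum_rankK_in.
apply/existsP; exists [ffun x => rk (g x)]; apply/andP; split.
  apply/forallP => x; apply/forallP => y; apply/implyP => /gP; rewrite !ffunE.
  by apply: contra_neq => /(congr1 enum_val); rewrite !rkK.
apply/forallP => c; apply/existsP; exists (enum_val c).
have cW := enum_valP c.
rewrite ffunE gid // /rk enum_valK_in eqxx; apply/forallP => d; apply/implyP.
rewrite ffunE gid // /rk enum_valK_in => dc.
have [|x [cx xN xd]] := nbhd_color_onto avoid W_deg cW (enum_valP d).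
  by apply: contraNneq dc => /enum_val_inj->.
by apply/existsP; exists x; rewrite cx ffunE gE // xd enum_valK_in eqxx.
Qed.

(** * Encircled sets *)

Definition encircled (W : {set T}) (u : T) : bool :=
  [forall z in W, e u z || [exists w in W, e u w && e w z]].

(** A vertex [z] witnessing that [u] does not encircle [W] is avoidable, the degree condition being
    vacuous. *)
Lemma unencircled_has_b_coloring (W : {set T}) : 1 < #|W| ->
  (forall w, w \in W -> #|W|.-1 <= degree e w) ->
  (forall x, x \notin closed_nbhd W -> degree e x < #|W|) ->
  (forall u, u \notin W -> ~~ encircled W u) ->
  has_b_coloring e #|W|.
Proof.
move=> W_gt1 W_deg lowdeg free; apply: good_set_has_b_coloring => // u uW.
have /forall_inPn[z zW] := free u uW.
rewrite negb_or => /andP[uz /exists_inPn no_w]; exists z => //.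
rewrite /avoidable uz; apply/forall_inP => w wW; apply/implyP => uwz.
by case/negP: (no_w w wW).
Qed.

(** Join the routes from [a] to [u] and from [u] to [b], of length at most 2 each; where they
    overlap, cutting the detour through [u] leaves length at most 2. *)
Lemma encircled_path (W : {set T}) u a b :
  u \notin W -> encircled W u -> a \in W -> b \in W -> a != b ->
  exists p, [/\ path e a p && reduced (a :: p), last a p = b, size p <= 4,
    {subset p <= u |: W} & u \in p \/ size p <= 2].
Proof.
move=> uW /forall_inP enc aW bW ab.
have sub p : all [in u |: W] p -> {subset p <= u |: W} by move/allP.
have [ua|nua] := boolP (e u a); have [ub|nub] := boolP (e u b).
- exists [:: u; b]; split; rewrite /= ?inE ?eqxx //; try by side.
    by apply: sub; rewrite /= !inE eqxx bW orbT.
  by left.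
- have := enc b bW; rewrite (negPf nub) => /exists_inP[w wW /andP[uw wb]].
  have [eq_wa|wa] := eqVneq w a.
    subst w; exists [:: b]; split; rewrite //= ?andbT //; last by right.
    by apply: sub; rewrite /= !inE bW orbT.
  exists [:: u; w; b]; split; rewrite //=; try by side.
    by apply: sub; rewrite /= !inE eqxx bW wW !orbT.
  by left; rewrite !inE eqxx.
- have := enc a aW; rewrite (negPf nua) => /exists_inP[w wW /andP[uw wa]].
  have [eq_wb|wb] := eqVneq w b.
    subst w; exists [:: b]; split; rewrite //= ?andbT //; first by adj.
    by apply: sub; rewrite /= !inE bW orbT.
    by right.
  exists [:: w; u; b]; split; rewrite //=; try by side.
    by apply: sub; rewrite /= !inE eqxx bW wW !orbT.
  by left; rewrite !inE eqxx orbT.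
have := enc a aW; rewrite (negPf nua) => /exists_inP[w wW /andP[uw wa]].
have := enc b bW; rewrite (negPf nub) => /exists_inP[w' w'W /andP[uw' wb]].
have [eq_w|ww'] := eqVneq w w'.
  subst w'; exists [:: w; b]; split; rewrite //=; try by side.
    by apply: sub; rewrite /= !inE bW wW !orbT.
  by right.
exists [:: w; u; w'; b]; split; rewrite //=; try by side.
  by apply: sub; rewrite /= !inE eqxx bW wW w'W !orbT.
by left; rewrite !inE eqxx orbT.
Qed.

(** The removed [r] stays in the new closed neighbourhood thanks to [r'], so every vertex left to
    the greedy colouring is outside [W]. *)
Lemma exchange_has_b_coloring (W : {set T}) r r' y : 1 < #|W| ->
  (forall w, w \in W -> #|W|.-1 <= degree e w) ->
  (forall x, x \notin W -> degree e x < #|W|) ->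
  r \in W -> r' \in W -> r' != r -> e r r' ->
  y \notin W -> #|W|.-1 <= degree e y ->
  (forall u, u \notin y |: (W :\ r) -> ~~ encircled (y |: (W :\ r)) u) ->
  has_b_coloring e #|W|.
Proof.
move=> W_gt1 W_deg lowdeg rW r'W r'r rr' yW y_deg free.
have cardE : #|y |: (W :\ r)| = #|W|.
  by rewrite cardsU1 !inE (negPf yW) andbF [in RHS](cardsD1 r) rW.
rewrite -cardE; apply: unencircled_has_b_coloring; rewrite ?cardE //.
  by move=> w; rewrite !inE => /predU1P[-> //|/andP[_ /W_deg]].
move=> x; rewrite inE negb_or => /andP[xW' /exists_inPn x_far].
apply: lowdeg; apply/negP => xW; have := x_far r'; rewrite !inE r'W r'r orbT => /(_ isT).
move: xW'; rewrite !inE negb_or xW andbT negbK => /andP[_ /eqP->].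
by rewrite rr'.
Qed.

Lemma exists_outside (W : {set T}) (s : seq T) :
  size s < #|W| -> exists2 x, x \in W & x \notin s.
Proof.
move=> lt_s; apply/exists_inP; apply: contraLR lt_s => /exists_inPn sW.
rewrite -leqNgt (leq_trans _ (card_size s)) // subset_leq_card //.
by apply/subsetP => x /sW/negPn.
Qed.

Lemma encircled_has_b_coloring (W : {set T}) u : 3 < #|W| ->
  (forall w, w \in W -> #|W|.-1 <= degree e w) ->
  (forall x, x \notin W -> degree e x < #|W|) ->
  u \notin W -> encircled W u ->
  has_b_coloring e #|W| \/ has_b_coloring e #|W|.-1.
Proof.
move=> W_gt3 W_deg lowdeg uW enc_u; have W_gt1 : 1 < #|W| by exact: ltn_trans W_gt3.
have encE z : z \in W -> ~~ e u z -> exists2 w, w \in W & e u w && e w z.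
  move=> zW uz; have := forall_inP enc_u z zW; rewrite (negPf uz) /=.
  by move/exists_inP.
have [w2 w2W uw2] : exists2 w, w \in W & ~~ e u w.
  apply/exists_inP; apply: contraTT (lowdeg u uW) => /exists_inPn all_uw.
  rewrite -leqNgt subset_leq_card //; apply/subsetP => w /all_uw.
  by rewrite inE negbK.
have [w1 w1W /andP[uw1 w12]] := encE w2 w2W uw2.
have w2w1 : w2 != w1 by rewrite eq_sym edge_neq.
have [/forallP near|] := boolP [forall y, (#|W|.-1 <= degree e y) ==> (y \in closed_nbhd W)];
  last first.
  (* Replace [w1] by the far vertex [y]. The short path from [w2] to [b] passes through [w1], so an
     encircling [v] would be [w1]; but [v] is adjacent to [y]. *)
  case/forallPn=> y; rewrite negb_imply => /andP[y_deg].
  rewrite inE negb_or => /andP[yW /exists_inPn yfar]; left.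
  apply: (exchange_has_b_coloring W_gt1 W_deg lowdeg w1W w2W w2w1 w12 yW y_deg).
  move=> v vW'; apply/negP => enc_v.
  have vy : e v y.
    have yW' : y \in y |: (W :\ w1) by rewrite !inE eqxx.
    case/orP: (forall_inP enc_v y yW') => // /exists_inP[w].
    rewrite !inE => /predU1P[->|/andP[_ wW]]; first by rewrite e_irr andbF.
    by case/andP=> _; rewrite e_sym (negPf (yfar w wW)).
  have [b bW] : exists2 b, b \in W & b \notin [:: w1; w2].
    by apply: exists_outside; apply: ltnW.
  rewrite !inE negb_or => /andP[bw1 bw2]; have w2b : w2 != b by rewrite eq_sym.
  have w2W' : w2 \in y |: (W :\ w1) by rewrite !inE w2w1 w2W orbT.
  have bW' : b \in y |: (W :\ w1) by rewrite !inE bw1 bW orbT.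
  have [p [/andP[pp rp] lp sp subp _]] := encircled_path vW' enc_v w2W' bW' w2b.
  have [q [pq rq lq sq]] : exists q, [/\ path e w2 (w1 :: q), reduced [:: w2, w1 & q],
      last w1 q = b & size q <= 3].
    have [ub|nub] := boolP (e u b).
      by exists [:: u; b]; split; rewrite //=; side.
    have [w wW /andP[uw wb]] := encE b bW nub.
    have [eq_w|ww1] := eqVneq w w1.
      by subst w; exists [:: b]; split; rewrite //=; side.
    by exists [:: u; w; b]; split; rewrite //=; side.
  have def_p : p = w1 :: q.
    apply: (short_path_unique pp pq rp rq); first by rewrite lp /= lq.
    by rewrite (leq_add sp).
  have : w1 \in v |: (y |: (W :\ w1)) by apply: subp; rewrite def_p mem_head.
  rewrite !inE eqxx /= orbF => /orP[/eqP eq_v|/eqP eq_y].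
    by have := yfar w1 w1W; rewrite eq_v e_sym vy.
  by rewrite -eq_y w1W in yW.
have {}near y : #|W|.-1 <= degree e y -> y \in closed_nbhd W by exact/implyP.
have [/exists_inP[w3 w3W /andP[w32 uw3]]|/exists_inPn all_u] :=
    boolP [exists w3 in W, (w3 != w2) && ~~ e u w3]; last first.
  (* Here the neighbours of [u] are exactly [W :\ w2], so [u] has degree [#|W|.-1] and can replace
     [w2]. *)
  have {}all_u w : w \in W :\ w2 -> e u w.
    by rewrite !inE => /andP[ww2 wW]; have := all_u w wW; rewrite ww2 negbK.
  have cardW : #|W| = #|W :\ w2|.+1 by rewrite (cardsD1 w2) w2W.
  have Nu : W :\ w2 = [set w | e u w].
    apply/eqP; rewrite eqEcard -ltnS -cardW lowdeg // andbT.
    by apply/subsetP => w /all_u; rewrite inE.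
  have u_deg : #|W|.-1 <= degree e u by rewrite /degree -Nu cardW.
  left; have w1w2 : w1 != w2 by rewrite eq_sym.
  have w21 : e w2 w1 by rewrite e_sym.
  apply: (exchange_has_b_coloring W_gt1 W_deg lowdeg w2W w1W w1w2 w21 uW u_deg).
  set W' := u |: _ => v vW'; apply/negP => enc_v.
  have uW' : u \in W' by rewrite !inE eqxx.
  have /orP[vu|/exists_inP[b bW' /andP[vb bu]]] := forall_inP enc_v u uW'.
    by case/negP: vW'; apply/setUP; right; rewrite Nu inE e_sym.
  have [b' b'W] : exists2 b', b' \in W & b' \notin [:: b; w2].
    by apply: exists_outside; apply: ltnW.
  rewrite !inE negb_or => /andP[b'b b'w2].
  have b'W2 : b' \in W :\ w2 by rewrite !inE b'w2.
  have b'W' : b' \in W' by rewrite inE b'W2 orbT.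
  have ub' := all_u b' b'W2.
  have /orP[vb'|/exists_inP[c cW' /andP[vc cb']]] := forall_inP enc_v b' b'W'.
    no_two_paths v [:: b'] [:: b; u; b'].
  no_two_paths v [:: c; b'] [:: b; u; b'].
have w3w1 : w3 != w1 by apply: contraNneq uw3 => ->.
have cardW : #|W :\ w2| = #|W|.-1 by rewrite [in RHS](cardsD1 w2) w2W.
have [/existsP[y /andP[y_deg yN]]|/existsPn near2] :=
  boolP [exists y, (#|W|.-1 <= degree e y) && (y \notin closed_nbhd (W :\ w2))]; last first.
  (* Drop [w2]: each remaining vertex has a spare neighbour, so avoidable means nonadjacent, and no
     [v] is adjacent to both [w3] and its neighbour [w4]. *)
  right; rewrite -cardW; apply: good_set_has_b_coloring; rewrite ?cardW.
  - by rewrite -ltnS prednK ?(ltn_trans _ W_gt3) // (ltn_trans _ W_gt3).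
  - by move=> w; rewrite !inE => /andP[_ /W_deg]; apply: leq_trans; rewrite leq_pred.
  - by move=> x xN; have := near2 x; rewrite xN andbT -ltnNge.
  move=> v vW2; have [w4 w4W /andP[uw4 w43]] := encE w3 w3W uw3.
  have w42 : w4 != w2 by apply: contraNneq uw2 => <-.
  suff [z zW vz] : exists2 z, z \in W :\ w2 & ~~ e v z.
    exists z => //; rewrite /avoidable vz; apply/forall_inP => w.
    by rewrite !inE cardW => /andP[_ /W_deg ->]; rewrite implybT.
  have [vw3|nvw3] := boolP (e v w3); last by exists w3; rewrite // !inE w32.
  exists w4; first by rewrite !inE w42.
  have v4 : v != w4 by apply: contraNneq vW2 => ->; rewrite !inE w42.
  apply/negP => vw4; no_two_paths v [:: w3; w4] [:: w4].
have {yN} [yW yw2] : y \notin W /\ e y w2.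
  move: yN; rewrite inE negb_or => /andP[yW2 /exists_inPn yfar].
  have yW : y \notin W.
    apply: contraNN yW2 => yW; rewrite !inE yW andbT.
    apply: contraTneq w12 => <-; rewrite e_sym; apply: yfar.
    by rewrite !inE eq_sym w2w1.
  split=> //; have := near y y_deg; rewrite inE (negPf yW) => /exists_inP[w wW yw].
  have [<- //|ww2] := eqVneq w w2.
  by have := yfar w; rewrite !inE ww2 wW yw => /(_ isT).
have yu : y != u by apply: contraTneq yw2 => ->.
left; have [/exists_inP[b bW /andP[bw1 ub]]|/exists_inPn star] :=
    boolP [exists b in W, (b != w1) && e u b].
  (* The path from [y] to [b] visits both [w1] and [u], neither in the new set, but an encircling
     vertex accounts for only one of them. *)
  apply: (exchange_has_b_coloring W_gt1 W_deg lowdeg w1W w2W w2w1 w12 yW y_deg).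
  set W' := y |: _ => v vW'; apply/negP => enc_v.
  have yW' : y \in W' by rewrite !inE eqxx.
  have bW' : b \in W' by rewrite !inE bw1 bW orbT.
  have yb : y != b by neq.
  have [p [/andP[pp rp] lp sp subp _]] := encircled_path vW' enc_v yW' bW' yb.
  have def_p : p = [:: w2; w1; u; b].
    have w2u : w2 != u by neq.
    apply: (short_path_unique pp _ rp); rewrite /= ?lp //; try by side.
    by rewrite (leq_add sp).
  have : w1 \in v |: W' by apply: subp; rewrite def_p !inE eqxx orbT.
  have : u \in v |: W' by apply: subp; rewrite def_p !inE eqxx !orbT.
  rewrite !inE eqxx (negPf uW) andbF orbF eq_sym [u == y]eq_sym (negPf yu) orbF.
  move=> /eqP->; rewrite orbF => /orP[/eqP eq_u|/eqP eq_y].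
    by rewrite -eq_u w1W in uW.
  by rewrite -eq_y w1W in yW.
(* Now [w1] is the only neighbour of [u] in [W], so [W] is a star around [w1]; a leaf [w3] is
   exchanged for [y]. *)
have center z : z \in W -> z != w1 -> e w1 z.
  move=> zW zw1; have := star z zW; rewrite zw1 => uz.
  have [w wW /andP[uw wz]] := encE z zW uz.
  by have := star w wW; rewrite uw andbT negbK => /eqP <-.
(* This fourth vertex is where [3 < #|W|] is needed. *)
have [c cW] : exists2 c, c \in W & c \notin [:: w1; w2; w3] by exact: exists_outside.
rewrite !inE !negb_or => /and3P[cw1 cw2 cw3].
have w13 : w1 != w3 by rewrite eq_sym.
have w31 : e w3 w1 by rewrite e_sym center.
apply: (exchange_has_b_coloring W_gt1 W_deg lowdeg w3W w1W w13 w31 yW y_deg).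
set W' := y |: _ => v vW'; apply/negP => enc_v.
have yW' : y \in W' by rewrite !inE eqxx.
have inW' a : a \in W -> a != w3 -> a \in W' by rewrite !inE => -> ->; rewrite orbT.
have yc : y != c by neq.
have [p [/andP[pp rp] lp sp _ vp]] := encircled_path vW' enc_v yW' (inW' c cW cw3) yc.
have w1c := center c cW cw1.
(* This path has length 3, so it must pass through [v], yet all its vertices lie in [W']. *)
have def_p : p = [:: w2; w1; c].
  apply: (short_path_unique pp _ rp); rewrite /= ?lp //; try by side.
  by rewrite (leq_trans (leq_add sp (leqnn 3))).
move: vp; rewrite def_p; case=> //; rewrite !inE => /or3P[] /eqP eq_v; case/negP: vW';
  by rewrite eq_v inW' // eq_sym.
Qed.
End LargeGirth.

(** * Vertices of largest degree and the bound *)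

Lemma exists_set_between (T : finType) (A B : {set T}) n :
  A \subset B -> #|A| <= n <= #|B| ->
  exists W : {set T}, [/\ A \subset W, W \subset B & #|W| = n].
Proof.
move=> AB /andP[An nB]; rewrite -(subnKC An) in nB *.
elim: (n - #|A|) nB => [|k IH] nB; first by exists A; rewrite addn0.
rewrite addnS in nB *; have [W [AW WB cardW]] := IH (ltnW nB).
have /subsetPn[x xB xW] : ~~ (B \subset W).
  by apply: contraL nB => /subset_leq_card; rewrite cardW -ltnNge ltnS.
exists (x |: W); rewrite cardsU1 xW cardW; split=> //.
  exact: subset_trans AW (subsetUr _ _).
by rewrite subUset sub1set xB.
Qed.

(** By maximality of [m_degree e], at most that many vertices have degree at least [m_degree e], so
    [W] can contain them all. *)
Lemma exists_top_degree_set (T : finType) (e : rel T) :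
  exists W : {set T}, [/\ #|W| = m_degree e,
    forall w, w \in W -> (m_degree e).-1 <= degree e w &
    forall x, x \notin W -> degree e x < m_degree e].
Proof.
set m := m_degree e.
have [||W [AW WB cardW]] := @exists_set_between T [set v | m <= degree e v]
    [set v | m.-1 <= degree e v] m.
- by apply/subsetP => v; rewrite !inE; apply: leq_trans; rewrite leq_pred.
- rewrite m_degree_attained andbT leqNgt; apply/negP => lt_m.
  by have := @leq_m_degree T e m.+1 lt_m; rewrite ltnn.
exists W; split=> // [w /(subsetP WB)|x]; first by rewrite inE.
by apply: contraNT; rewrite -leqNgt => x_deg; apply: (subsetP AW); rewrite inE.
Qed.

Lemma edge_chi_b_gt1 (T : finType) (e : rel T) x y :
  irreflexive e -> symmetric e -> e x y -> 1 < chi_b e.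
Proof.
move=> e_irr e_sym xy.
have /existsP[f /andP[/forallP/(_ x)/forallP/(_ y)/implyP/(_ xy)]] :=
  has_b_coloring_chi_b e_irr e_sym.
move: f; case: (chi_b e) => [|[|k]] f //; first by case: (f x).
by rewrite [f x]ord1 [f y]ord1.
Qed.

Theorem theorem1 (T : finType) (e : rel T)
    (e_sym : symmetric e) (e_irr : irreflexive e)
    (girth9 : girth_at_least e 9) :
  m_degree e - 1 <= chi_b e.
Proof.
rewrite subn1; have [m_le1|m_gt1] := leqP (m_degree e) 1.
  by move: m_le1; case: (m_degree e) => [|[]].
have [W [cardW W_deg lowdeg]] := exists_top_degree_set e.
(* Up to 3 the bound asks for at most two colours, and an edge forces two. *)
have [m_le3|m_gt3] := leqP (m_degree e) 3.
  have /card_gt0P[w wW] : 0 < #|W| by rewrite cardW ltnW.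
  have /card_gt0P[x] : 0 < degree e w.
    by apply: leq_trans (W_deg w wW); rewrite -ltnS prednK // ltnW.
  rewrite inE => /(edge_chi_b_gt1 e_irr e_sym); apply: leq_trans.
  by rewrite -ltnS prednK // ltnW.
rewrite -cardW in m_gt1 m_gt3 W_deg lowdeg *.
have [/existsP[u /andP[uW enc]]|/existsPn free] :=
    boolP [exists u, (u \notin W) && encircled e W u].
  case: (encircled_has_b_coloring e_sym e_irr girth9 m_gt3 W_deg lowdeg uW enc) => /leq_chi_b //.
  by apply: leq_trans; rewrite leq_pred.
apply: leq_trans (leq_pred _) _; apply: leq_chi_b.
apply: (unencircled_has_b_coloring e_sym e_irr girth9 m_gt1 W_deg) => [x|u uW].
  by rewrite inE negb_or => /andP[/lowdeg].
by have := free u; rewrite uW.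
Qed.
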